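(* Let $\mathcal J=(\mathcal S,\mathcal A,\gamma,J)$ be a finite JMDP. Assume that all optimal selectors have a common second-moment fixed point: for every pair of optimal selectors $\sigma,\sigma'$, the unique fixed points $M^\sigma$ of $\mathcal B^*_\sigma$ and $M^{\sigma'}$ of $\mathcal B^*_{\sigma'}$ agree, and write $M^*:=M^\sigma=M^{\sigma'}$. Start from any $q_0\in\mathbb R^{\mathcal S\times\mathcal A}$ and $M_0\in\mathbb R^{(\mathcal S\times\mathcal A)^2}$. At each iteration $k\ge0$ choose any greedy selector $\sigma_k:\mathcal S\to\mathcal A$ with $$\sigma_k(s)\in\arg\max_{c\in\mathcal A}q_k(s,c)\quad\text{for all }s\in\mathcal S,$$ update $$q_{k+1}(s,a)=r(s,a)+\gamma\sum_{s'\in\mathcal S}P_S(s'\mid s,a)\max_{c\in\mathcal A}q_k(s',c),$$ and update $$\begin{aligned}M_{k+1}(s,a,\tilde s,\tilde a)=\mathbb E\Bigl[&R^a\tilde R^{\tilde a}+\gamma R^a q_k\bigl(\tilde S'^{\tilde a},\sigma_k(\tilde S'^{\tilde a})\bigr)+\gamma\tilde R^{\tilde a}q_k\bigl(S'^a,\sigma_k(S'^a)\bigr)\\&+\gamma^2M_k\bigl(S'^a,\sigma_k(S'^a),\tilde S'^{\tilde a},\sigma_k(\tilde S'^{\tilde a})\bigr)\,\Bigm|\,S=s,\tilde S=\tilde s\Bigr],\end{aligned}$$ where the expectation uses the one-step coupling. Then $q_k\to Q^*$ and $M_k\to M^*$ as $k\to\infty$.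
   Context: **JMDP.** A finite JMDP is a tuple $\mathcal J=(\mathcal S,\mathcal A,\gamma,J)$ with $\mathcal S,\mathcal A$ finite nonempty sets, $\gamma\in(0,1)$, and $J$ a Markov kernel assigning to each $s\in\mathcal S$ a probability measure $J(\cdot\mid s)$ on $([0,1]\times\mathcal S)^{|\mathcal A|}$; a draw $((R^a,S'^a))_{a\in\mathcal A}\sim J(\cdot\mid s)$ is called an outcome table at $s$. **Marginal MDP.** The induced marginal MDP has reward-transition kernel equal to the law of $(R^a,S'^a)$ under $J(\cdot\mid s)$. Write $r(s,a)=\mathbb E[R^a\mid s]$ and $P_S(\cdot\mid s,a)$ for the law of $S'^a$ under $J(\cdot\mid s)$. Its optimal action-value function $Q^*$ is the unique fixed point of $(TQ)(s,a)=r(s,a)+\gamma\sum_{s'}P_S(s'\mid s,a)\max_{b\in\mathcal A}Q(s',b)$. **One-step coupling.** In expectations conditional on $S=s,\tilde S=\tilde s$, the outcomes $(R^a,S'^a)$ and $(\tilde R^{\tilde a},\tilde S'^{\tilde a})$ are sampled as follows. If $s=\tilde s$, draw one table from $J(\cdot\mid s)$ and let the two outcomes be its $a$ and $\tilde a$ coordinates (so they coincide if also $a=\tilde a$). If $s\ne\tilde s$, draw independent tables from $J(\cdot\mid s)$ and $J(\cdot\mid\tilde s)$ and take the $a$ coordinate of the first and the $\tilde a$ coordinate of the second. **Optimal selectors and second-moment operators.** Let $\mathcal A^*(s)=\arg\max_{a\in\mathcal A}Q^*(s,a)$. An optimal selector is a map $\sigma:\mathcal S\to\mathcal A$ with $\sigma(s)\in\mathcal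 A^*(s)$ for all $s$. For such $\sigma$ and $M\in\mathbb R^{(\mathcal S\times\mathcal A)^2}$ define $$\begin{aligned}[\mathcal B^*_\sigma M](s,a,\tilde s,\tilde a)=\mathbb E\Bigl[&R^a\tilde R^{\tilde a}+\gamma R^aQ^*\bigl(\tilde S'^{\tilde a},\sigma(\tilde S'^{\tilde a})\bigr)+\gamma\tilde R^{\tilde a}Q^*\bigl(S'^a,\sigma(S'^a)\bigr)\\&+\gamma^2M\bigl(S'^a,\sigma(S'^a),\tilde S'^{\tilde a},\sigma(\tilde S'^{\tilde a})\bigr)\,\Bigm|\,S=s,\tilde S=\tilde s\Bigr],\end{aligned}$$ with the one-step coupling. Each $\mathcal B^*_\sigma$ is a $\gamma^2$-contraction in the sup norm, and $M^\sigma$ denotes its unique fixed point. *)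

(* Defs.v *)
From HB Require Import structures.
From mathcomp Require Import all_boot all_order all_algebra.
From mathcomp Require Import all_classical all_reals all_analysis.

Set Implicit Arguments.
Unset Strict Implicit.
Unset Printing Implicit Defensive.

Import Order.TTheory GRing.Theory Num.Theory.
Import numFieldNormedType.Exports.

Local Open Scope classical_set_scope.
Local Open Scope ring_scope.

(* Finite nonempty types; the point only witnesses nonemptiness. *)
#[short(type="finPointedType")]
HB.structure Definition FinPointed := {T of Finite T & isPointed T}.

(* A finite set with the sigma-algebra of all its subsets. *)
Definition discrete_space (S : Type) : Type := S.

HB.instance Definition _ (S : finPointedType) :=
  FinPointed.on (discrete_space S).
HB.instance Definition _ (S : finPointedType) :=
  @isMeasurable.Build default_measure_display (discrete_space S)
    discrete_measurable discrete_measurable0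
    discrete_measurableC discrete_measurableU.

Definition unit_itv (R : realType) : Type := {i01 R}.

HB.instance Definition _ (R : realType) := Choice.on (unit_itv R).
HB.instance Definition _ (R : realType) :=
  isPointed.Build (unit_itv R) (0%:i01 : {i01 R}).

Definition unit_itv_val (R : realType) (x : unit_itv R) : measurableTypeR R :=
  (x : {i01 R})%:num.

(* [0, 1] with its Borel sigma-algebra, the trace of that of R. *)
Definition reward (R : realType) : Type :=
  g_sigma_algebra_preimageType (@unit_itv_val R).

HB.instance Definition _ (R : realType) := Measurable.on (reward R).

(* ([0, 1] * S)^|A| with the product sigma-algebra; coordinates are indexed by
   A through enum_rank. *)
Definition outcome_table (R : realType) (S A : finPointedType) : Type :=
  #|A|.-tuple (reward R * discrete_space S)%type.

HB.instance Definition _ (R : realType) (S A : finPointedType) :=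
  Measurable.on (outcome_table R S A).

(* Every map out of the finite discrete space of states is measurable, so a
   Markov kernel from states is a family of probability measures. *)
Record jmdp (R : realType) := JMDP {
  state : finPointedType;
  action : finPointedType;
  discount : R;
  discount_itv : 0 < discount < 1;
  table_law : state -> probability (outcome_table R state action) R }.

Section jmdp_theory.
Context {R : realType} (J : jmdp R).

Local Notation S := (state J).
Local Notation A := (action J).
Local Notation gamma := (discount J).
Local Notation table := (outcome_table R S A).

Definition table_reward (t : table) (a : A) : R :=
  unit_itv_val (tnth t (enum_rank a)).1.

Definition table_next (t : table) (a : A) : S := (tnth t (enum_rank a)).2.

Definition mean_reward (s : S) (a : A) : R :=
  \int[table_law s]_t table_reward t a.

Definition next_prob (s : S) (a : A) (s' : S) : R :=
  fine (table_law s [set t | table_next t a = s']).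

(* The seed of the fold is a value of f, so this is the maximum of f. *)
Definition max_action (f : A -> R) : R := \big[Num.max/f point]_(b : A) f b.

Definition argmax (f : A -> R) : set A := [set c | forall b, f b <= f c].

Definition bellman (Q : S -> A -> R) (s : S) (a : A) : R :=
  mean_reward s a
  + gamma * \sum_(s' : S) next_prob s a s' * max_action (Q s').

(* Bellman and second-moment operators are contractions, so the sets below are
   singletons and the default value 0 is never taken. *)
Definition Qstar : S -> A -> R :=
  xget (fun _ _ => 0) [set Q | bellman Q = Q].

Definition greedy (Q : S -> A -> R) (sigma : S -> A) : Prop :=
  forall s, argmax (Q s) (sigma s).

Definition optimal_selector (sigma : S -> A) : Prop := greedy Qstar sigma.

(* Expectation of X t t' under the one-step coupling at (s, s'): the two tables
   are one and the same draw if s = s', and independent draws otherwise. *)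
Definition coupled_mean (s s' : S) (X : table -> table -> R) : R :=
  if s == s' then \int[table_law s]_t X t t
  else \int[(table_law s \x table_law s')%E]_tt X tt.1 tt.2.

Definition second_moment_step (q : S -> A -> R) (sigma : S -> A)
    (M : S -> A -> S -> A -> R) (s : S) (a : A) (s' : S) (a' : A) : R :=
  coupled_mean s s' (fun t t' =>
    let r := table_reward t a in
    let r' := table_reward t' a' in
    let x := table_next t a in
    let x' := table_next t' a' in
    r * r' + gamma * r * q x' (sigma x') + gamma * r' * q x (sigma x)
    + gamma ^+ 2 * M x (sigma x) x' (sigma x')).

Definition second_moment_op (sigma : S -> A) :
    (S -> A -> S -> A -> R) -> S -> A -> S -> A -> R :=
  second_moment_step Qstar sigma.

Definition second_moment_fixpoint (sigma : S -> A) : S -> A -> S -> A -> R :=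
  xget (fun _ _ _ _ => 0) [set M | second_moment_op sigma M = M].

End jmdp_theory.

(* Main.v *)
Require Import Defs.
From HB Require Import structures.
From mathcomp Require Import all_boot all_order all_algebra.
From mathcomp Require Import all_classical all_reals all_analysis.
From mathcomp Require Import measurable_realfun ring lra.

Set Implicit Arguments.
Unset Strict Implicit.
Unset Printing Implicit Defensive.

Import Order.TTheory GRing.Theory Num.Theory.
Import numFieldNormedType.Exports.

Local Open Scope classical_set_scope.
Local Open Scope ring_scope.

(** Value iteration converges because the Bellman operator is a
    gamma-contraction in the sup norm.  By finiteness, q_k -> Qstar forces
    every greedy selector of q_k to be optimal from some rank on.  From there
    on the common fixed point M* is fixed by the operator of the selector
    sigma_k actually used, so, comparing both updates under the same sigma_k,
    |M_{k+1} - M*| <= gamma^2 |M_k - M*| + 2 gamma |q_k - Qstar|,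
    and the last term tends to 0. *)

(** * Contractions on functions over a finite index set *)

Section fin.
Context {R : realType} {I : finType}.
Implicit Types (f g : I -> R) (c e : R).

Lemma finite_bound f : exists C, forall i, `|f i| <= C.
Proof. by exists (\big[Num.max/0]_i `|f i|) => i; exact: le_bigmax. Qed.

(** Errors obeying [u -> c * u + d] settle near [d / (1 - c)], which is small with [d]. The rank
    depends on [d] but not on the bound [e], so the estimate can be iterated from that rank on. *)
Lemma perturbed_contraction_cvg c (x : nat -> I -> R) (y : I -> R) :
    0 <= c < 1 ->
    (forall d, 0 < d -> \forall n \near \oo, forall e,
      (forall i, `|x n i - y i| <= e) ->
      forall i, `|x n.+1 i - y i| <= c * e + d) ->
  forall i, x n i @[n --> \oo] --> y i.
Proof.
move=> /andP[c0 c1] xS i; apply/cvgrPdist_le => e e0.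
(* This [d] makes [e / 2] the fixed point of [u -> c * u + d]; only the excess over [e / 2] then
   decays, like [c ^+ m]. *)
have d0 : 0 < (1 - c) * (e / 2) by rewrite mulr_gt0 ?subr_gt0// divr_gt0.
have [N _ xN] := xS _ d0.
have [C CE] := finite_bound (fun j => x N j - y j).
have xNm m j : `|x (N + m)%N j - y j| <= C * c ^+ m + e / 2.
  elim: m j => [|m IH] j.
    by rewrite addn0 expr0 mulr1 (le_trans (CE j))// lerDl ltW// divr_gt0.
  rewrite addnS (le_trans (xN (N + m)%N _ _ IH j))//= ?leq_addr//.
  by rewrite exprS; lra.
have e20 : 0 < e / 2 by rewrite divr_gt0.
have cn1 : `|c| < 1 by rewrite ger0_norm.
have [N' _ cN'] := cvgr0_norm_le _ (cvg_geometric C cn1) _ e20.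
exists (N + N')%N => // n /= Nn.
have N'n : (N' <= n - N)%N by rewrite leq_subRL ?(leq_trans _ Nn)// leq_addr.
rewrite distrC -(subnKC (leq_trans (leq_addr N' N) Nn)).
rewrite (le_trans (xNm _ _))// [leRHS]splitr lerD2r.
by rewrite (le_trans (ler_norm _)) ?cN'.
Qed.

(** Picard iteration from 0: the increments are dominated by a geometric series, so each coordinate
    converges, and the limit is fixed because [F] is continuous in the sup norm. *)
Lemma sup_contraction_fixpoint c (F : (I -> R) -> I -> R) :
    0 <= c < 1 ->
    (forall f g e, (forall i, `|f i - g i| <= e) ->
      forall i, `|F f i - F g i| <= c * e) ->
  exists f, F f = f.
Proof.
move=> /andP[c0 c1] Fc; pose x n := iter n F (fun=> 0).
have [C CE] := finite_bound (fun i => x 1%N i - x 0%N i).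
have xS n i : `|x n.+1 i - x n i| <= C * c ^+ n.
  elim: n i => [|n IH] i; first by rewrite mulr1 CE.
  by rewrite exprS mulrCA; exact: Fc.
have xcvg i : cvgn (x^~ i).
  have : cvgn (series (telescope (x^~ i))).
    apply: normed_cvg.
    apply: (series_le_cvg (v_ := geometric C c)) => //= [n|n|].
    - by rewrite (le_trans (normr_ge0 _) (xS n i)).
    - exact: xS.
    - by apply: is_cvg_geometric_series; rewrite ger0_norm.
  rewrite telescopeK => h.
  (* The telescoping series has partial sums [x n i - x 0 i]; the constant is added back. *)
  have -> : x^~ i = (fun n => x n i - x 0%N i) \+ cst (x 0%N i).
    by apply/funext => n /=; rewrite subrK.
  by apply: is_cvgD => //; exact: is_cvg_cst.
exists (fun i => limn (x^~ i)); apply/funext => i.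
set y := fun i => _; apply/esym.
apply: (@cvg_unique _ _ (x n.+1 i @[n --> \oo])) => //.
  have : x^~ i n @[n --> \oo] --> y i by exact: xcvg.
  by rewrite -(cvg_shiftS (x^~ i)).
apply/cvgrPdist_le => e e0.
(* Finiteness of [I] upgrades coordinatewise convergence to uniform convergence, the form that the
   contraction hypothesis accepts. *)
have : \forall n \near \oo, forall j, `|y j - x n j| <= e.
  by apply: filter_forall => j; move/cvgrPdist_le : (xcvg j); exact.
apply: filterS => n yx; rewrite (le_trans (Fc _ _ _ yx i))//.
by rewrite ler_piMl// ltW.
Qed.
End fin.

(** * Integration of bounded measurable functions *)

Section meas.
Context {d} {T : measurableType d} {R : realType}.

Lemma measurable_finite_comp (I : finType) (f : T -> I) (g : I -> R) :
  (forall i, measurable (f @^-1` [set i])) -> measurable_fun setT (g \o f).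
Proof.
move=> mf _ B mB; rewrite setTI.
have -> : (g \o f) @^-1` B = \bigcup_(i in g @^-1` B) f @^-1` [set i].
  apply/seteqP; split => [t Bt|t [i Bi fti]]; first by exists (f t).
  by move: Bi; rewrite -fti.
exact: fin_bigcup_measurable.
Qed.

(** A class closed under sums, products and measurable composition, and contained in the integrable
    functions of every probability; integrability of the second-moment integrand then follows from
    its shape. *)
Definition bounded_measurable (f : T -> R) :=
  measurable_fun setT f /\ exists C, forall t, `|f t| <= C.

Lemma bounded_measurable_cst (c : R) : bounded_measurable (fun=> c).
Proof. by split => //; exists `|c|. Qed.

Lemma bounded_measurableD (f g : T -> R) : bounded_measurable f ->
  bounded_measurable g -> bounded_measurable (fun t => f t + g t).
Proof.
move=> [mf [C fC]] [mg [D gD]]; split; first exact: measurable_funD.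
by exists (C + D) => t; rewrite (le_trans (ler_normD _ _))// lerD.
Qed.

Lemma bounded_measurableM (f g : T -> R) : bounded_measurable f ->
  bounded_measurable g -> bounded_measurable (fun t => f t * g t).
Proof.
move=> [mf [C fC]] [mg [D gD]]; split; first exact: measurable_funM.
by exists (C * D) => t; rewrite normrM ler_pM.
Qed.

Lemma bounded_measurable_finite (I : finType) (f : T -> I) (g : I -> R) :
  (forall i, measurable (f @^-1` [set i])) ->
  bounded_measurable (fun t => g (f t)).
Proof.
move=> mf; split; first exact: measurable_finite_comp.
by have [C gC] := @finite_bound R I g; exists C => t; exact: gC.
Qed.

Lemma bounded_measurable_integrable (P : probability T R) (f : T -> R) :
  bounded_measurable f -> P.-integrable setT (EFin \o f).
Proof.
move=> [mf [C fC]]; apply: measurable_bounded_integrable => //.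
  exact: (le_lt_trans (probability_le1 P measurableT) (ltry 1)).
by exists C; split; [exact: num_real|move=> M CM t _];
  exact: le_trans (fC t) (ltW CM).
Qed.

Lemma Rintegral_dist (P : probability T R) (f g : T -> R) (e : R) :
    bounded_measurable f -> bounded_measurable g ->
    (forall t, `|f t - g t| <= e) ->
  `|\int[P]_t f t - \int[P]_t g t| <= e.
Proof.
move=> bf bg fge.
have bfg : bounded_measurable (fun t => f t - g t).
  have [mf _] := bf; have [mg _] := bg.
  by split; [exact: measurable_funB|exists e].
have /= ifg := bounded_measurable_integrable P bfg.
rewrite -RintegralB//; try exact: bounded_measurable_integrable.
rewrite (le_trans (le_normr_Rintegral _ _))//.
apply: (@le_trans _ _ (\int[P]_t e)).
  apply: le_Rintegral => //; first exact: integrable_norm.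
  exact/bounded_measurable_integrable/bounded_measurable_cst.
by rewrite Rintegral_cst// [X in fine X]probability_setT mulr1.
Qed.

(** The fibres of [f] partition [T]. Applied to the next state, it makes the rows of [next_prob] sum
    to 1. *)
Lemma sum_preimage_probability (I : finType) (P : probability T R) (f : T -> I) :
    (forall i, measurable (f @^-1` [set i])) ->
  \sum_i fine (P (f @^-1` [set i])) = 1.
Proof.
move=> mf; apply: EFin_inj; rewrite -sumEFin -(probability_setT P).
have -> : [set: T] = \bigcup_(i in [set: I]) f @^-1` [set i].
  by apply/seteqP; split => // t _; exists (f t).
rewrite measure_fin_bigcup//; [|exact: finite_finset|]; last first.
  apply/trivIsetP => i j _ _ /eqP ij; apply/seteqP; split => // t [fi fj].
  by case: ij; rewrite -fi -fj.
under eq_bigr => i _ do rewrite fineK ?fin_num_measure//.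
rewrite fsbig_seq ?index_enum_uniq// (_ : [set` _] = setT)//.
by apply/seteqP; split => // i _; rewrite /= mem_index_enum.
Qed.

End meas.

Lemma bounded_measurable_comp d1 d2 (T1 : measurableType d1)
    (T2 : measurableType d2) (R : realType) (f : T2 -> R) (g : T1 -> T2) :
  bounded_measurable f -> measurable_fun setT g ->
  bounded_measurable (fun t => f (g t)).
Proof.
move=> [mf [C fC]] mg; split; first exact: measurableT_comp mf mg.
by exists C => t; exact: fC.
Qed.

(** * Lipschitz estimates and fixed points of the JMDP operators *)

Section jmdp.
Context {R : realType} (J : jmdp R).
Local Notation S := (state J).
Local Notation A := (action J).
Local Notation gamma := (discount J).
Local Notation table := (outcome_table R S A).

Lemma discount_ge0 : 0 <= gamma.
Proof. by have /andP[/ltW] := discount_itv J. Qed.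

Lemma table_reward_itv (t : table) (a : A) : 0 <= table_reward t a <= 1.
Proof. by rewrite /table_reward /unit_itv_val ge0 le1. Qed.

Lemma bounded_measurable_reward (a : A) :
  bounded_measurable (fun t : table => table_reward t a).
Proof.
split; last first.
  exists 1 => t; have /andP[r0 r1] := table_reward_itv t a.
  by rewrite ger0_norm.
have mval : measurable_fun setT (@unit_itv_val R : reward R -> measurableTypeR R).
  (* The sigma-algebra on rewards consists of the preimages themselves. *)
  by move=> _ B mB; exists B.
apply: (measurableT_comp mval (g := fun t : table => (tnth t (enum_rank a)).1)).
exact: measurableT_comp measurable_fst (measurable_tnth _).
Qed.

Lemma measurable_table_next (a : A) (s : S) :
  measurable [set t : table | table_next t a = s].
Proof.
have mnext : measurable_fun setT
    (fun t : table => (table_next t a : discrete_space S)).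
  exact: measurableT_comp measurable_snd (measurable_tnth _).
by have := mnext measurableT [set s] Logic.I; rewrite setTI.
Qed.

(** The fibres of the pair of next states are measurable rectangles. A [g] constant in one argument
    covers the terms that involve a single next state. *)
Lemma bounded_measurable_next (a a' : A) (g : S -> S -> R) :
  bounded_measurable (fun tt : table * table =>
    g (table_next tt.1 a) (table_next tt.2 a')).
Proof.
apply: (bounded_measurable_finite
  (f := fun tt : table * table => (table_next tt.1 a, table_next tt.2 a'))
  (fun p => g p.1 p.2)) => -[s s'].
rewrite (_ : _ @^-1` _ = [set t | table_next t a = s] `*`
                         [set t | table_next t a' = s']); last first.
  by apply/seteqP; split => [tt [<- <-]|[t t'] [/= <- <-]].
by apply: measurableX; exact: measurable_table_next.
Qed.

Lemma coupled_mean_dist (s s' : S) (X Y : table -> table -> R) (e : R) :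
    bounded_measurable (fun tt => X tt.1 tt.2) ->
    bounded_measurable (fun tt => Y tt.1 tt.2) ->
    (forall t t', `|X t t' - Y t t'| <= e) ->
  `|coupled_mean s s' X - coupled_mean s s' Y| <= e.
Proof.
move=> bX bY XYe; rewrite /coupled_mean; case: ifPn => _; last first.
  by apply: (Rintegral_dist (table_law s \x table_law s')%E bX bY) => tt.
(* The shared draw is the pullback along the diagonal, so hypotheses on the product space serve both
   branches of the coupling. *)
have mdiag : measurable_fun setT (fun t : table => (t, t)).
  exact: measurable_fun_pair.
by apply: Rintegral_dist => //;
  [exact: bounded_measurable_comp bX mdiag|
   exact: bounded_measurable_comp bY mdiag].
Qed.

Lemma second_moment_step_dist (q q' : S -> A -> R) (sigma : S -> A)
    (M M' : S -> A -> S -> A -> R) (d e : R) :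
    (forall s a, `|q s a - q' s a| <= d) ->
    (forall s a s' a', `|M s a s' a' - M' s a s' a'| <= e) ->
  forall s a s' a',
    `|second_moment_step q sigma M s a s' a'
      - second_moment_step q' sigma M' s a s' a'|
    <= gamma ^+ 2 * e + 2 * gamma * d.
Proof.
move=> qd Me s a s' a'.
have bm p N : bounded_measurable (fun tt : table * table =>
    table_reward tt.1 a * table_reward tt.2 a'
    + gamma * table_reward tt.1 a
        * p (table_next tt.2 a') (sigma (table_next tt.2 a'))
    + gamma * table_reward tt.2 a'
        * p (table_next tt.1 a) (sigma (table_next tt.1 a))
    + gamma ^+ 2 * N (table_next tt.1 a) (sigma (table_next tt.1 a))
                     (table_next tt.2 a') (sigma (table_next tt.2 a'))).
  have b1 := bounded_measurable_comp (bounded_measurable_reward a)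
    (measurable_fst : measurable_fun setT (@fst table table)).
  have b2 := bounded_measurable_comp (bounded_measurable_reward a')
    (measurable_snd : measurable_fun setT (@snd table table)).
  have bg := bounded_measurable_cst (T := (table * table)%type) gamma.
  apply: bounded_measurableD; first apply: bounded_measurableD;
    first apply: bounded_measurableD.
  - exact: bounded_measurableM.
  - apply: bounded_measurableM; first exact: bounded_measurableM.
    exact: (bounded_measurable_next a a' (fun _ x => p x (sigma x))).
  - apply: bounded_measurableM; first exact: bounded_measurableM.
    exact: (bounded_measurable_next a a' (fun x _ => p x (sigma x))).
  - apply: bounded_measurableM; first exact: bounded_measurable_cst.
    exact: (bounded_measurable_next a a' (fun x x' => N x (sigma x) x' (sigma x'))).
apply: coupled_mean_dist; [exact: bm|exact: bm|] => t t' /=.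
have /andP[r0 r1] := table_reward_itv t a.
have /andP[r'0 r'1] := table_reward_itv t' a'.
set r := table_reward t a in r0 r1 *; set r' := table_reward t' a' in r'0 r'1 *.
set x := table_next t a; set x' := table_next t' a'.
(* With the same [sigma] on both sides, [r * r'] cancels and the remaining terms are compared at the
   same arguments. Rewards in [0, 1] then bound each cross term by [gamma * d]. *)
rewrite (_ : _ - _ =
  gamma ^+ 2 * (M x (sigma x) x' (sigma x') - M' x (sigma x) x' (sigma x'))
  + (gamma * r * (q x' (sigma x') - q' x' (sigma x'))
  + gamma * r' * (q x (sigma x) - q' x (sigma x)))); last by ring.
have g0 := discount_ge0.
have rd (u v : R) : 0 <= u -> u <= 1 -> `|v| <= d ->
    `|gamma * u * v| <= gamma * d.
  move=> u0 u1 vd; rewrite !normrM (ger0_norm g0) (ger0_norm u0) -mulrA ler_wpM2l//.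
  by rewrite (le_trans _ vd)// ler_piMl.
rewrite (le_trans (ler_normD _ _))// lerD//.
  by rewrite normrM ger0_norm ?exprn_ge0// ler_wpM2l ?exprn_ge0.
rewrite (le_trans (ler_normD _ _))//.
rewrite (_ : 2 * gamma * d = gamma * d + gamma * d); last by ring.
by rewrite lerD// rd.
Qed.

Lemma max_action_dist (f g : A -> R) (e : R) :
  (forall a, `|f a - g a| <= e) -> `|max_action f - max_action g| <= e.
Proof.
have half h k : (forall a, `|h a - k a| <= e) -> max_action h <= max_action k + e.
  move=> hk; have hb a : h a <= max_action k + e.
    have := hk a; rewrite ler_norml => /andP[_]; rewrite lerBlDl => /le_trans.
    by apply; rewrite lerD2r; exact: le_bigmax.
  (* The seed [h point] must be bounded too; [hb] covers it, as it is a value of [h]. *)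
  exact: bigmax_le.
move=> fg; rewrite ler_norml; apply/andP; split.
  by rewrite lerBrDl lerBlDr half// => a; rewrite distrC.
by rewrite lerBlDl half.
Qed.

Lemma bellman_dist (Q Q' : S -> A -> R) (e : R) :
    (forall s a, `|Q s a - Q' s a| <= e) ->
  forall s a, `|bellman Q s a - bellman Q' s a| <= gamma * e.
Proof.
move=> QQ' s a; rewrite /bellman opprD addrACA subrr add0r -mulrBr normrM.
rewrite (ger0_norm discount_ge0) ler_wpM2l ?discount_ge0// -sumrB.
rewrite (le_trans (ler_norm_sum _ _ _))//.
(* Writing the factor 1 as the total transition probability allows a comparison term by term. *)
rewrite -[leRHS]mul1r -(sum_preimage_probability (table_law s)
  (f := fun t => table_next t a) (measurable_table_next a)) mulr_suml.
apply: ler_sum => s' _.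
rewrite -mulrBr normrM ger0_norm ?fine_ge0 ?measure_ge0//.
by rewrite ler_wpM2l ?fine_ge0 ?measure_ge0// max_action_dist.
Qed.

(** [xget] satisfies its predicate once a witness exists; the contraction provides one after
    uncurrying to the finite type [S * A]. *)
Lemma bellman_Qstar : bellman (Qstar (J := J)) = Qstar (J := J).
Proof.
apply: (@xgetPex _ _ [set Q | bellman Q = Q]).
pose F (f : S * A -> R) p := bellman (fun s a => f (s, a)) p.1 p.2.
have [|f g e fg p|f Ff] := @sup_contraction_fixpoint R (S * A)%type gamma F.
- by have /andP[/ltW-> ->] := discount_itv J.
- by apply: bellman_dist => s a; exact: fg.
- exists (fun s a => f (s, a)); apply/funext => s; apply/funext => a.
  by rewrite -{2}Ff.
Qed.

Lemma second_moment_fixpointE (sigma : S -> A) :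
  second_moment_step (Qstar (J := J)) sigma (second_moment_fixpoint sigma)
  = second_moment_fixpoint sigma.
Proof.
apply: (@xgetPex _ _ [set M | second_moment_op sigma M = M]).
pose F (f : S * A * S * A -> R) p := second_moment_op sigma
  (fun s a s' a' => f (s, a, s', a')) p.1.1.1 p.1.1.2 p.1.2 p.2.
have [|f g e fg p|f Ff] :=
  @sup_contraction_fixpoint R (S * A * S * A)%type (gamma ^+ 2) F.
- have /andP[/ltW g0 g1] := discount_itv J.
  by rewrite exprn_ge0//= exprn_ilt1.
(* Both sides use [Qstar], so the distance estimate applies with [d = 0]. *)
- rewrite -[leRHS]addr0 -(mulr0 (2 * gamma)); apply: second_moment_step_dist.
    by move=> s a; rewrite subrr normr0.
  by move=> s a s' a'; exact: fg.
- exists (fun s a s' a' => f (s, a, s', a')).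
  apply/funext => s; apply/funext => a; apply/funext => s'; apply/funext => a'.
  by rewrite -{2}Ff.
Qed.

(** Each strict inequality between values of [Q'] eventually holds for [Q k], and there are finitely
    many of them; an action suboptimal for [Q'] thus cannot stay greedy. The rank is uniform in
    [sigma], since the selector varies with [k]. *)
Lemma near_greedy (Q : nat -> S -> A -> R) (Q' : S -> A -> R) :
    (forall s a, Q k s a @[k --> \oo] --> Q' s a) ->
  \forall k \near \oo, forall sigma, greedy (Q k) sigma -> greedy Q' sigma.
Proof.
move=> QQ'.
have : \forall k \near \oo, forall p : S * A * A,
    Q' p.1.1 p.1.2 < Q' p.1.1 p.2 -> Q k p.1.1 p.1.2 < Q k p.1.1 p.2.
  apply: filter_forall => -[[s a] b] /=.
  have [lt_ab|_] := boolP (Q' s a < Q' s b); last by apply: nearW.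
  rewrite -subr_gt0 in lt_ab.
  apply: filterS (cvgr_gt _ (cvgB (QQ' s b) (QQ' s a)) _ lt_ab) => k lt_k _.
  by rewrite -subr_gt0.
apply: filterS => k Qk sigma gr s b; rewrite leNgt; apply/negP => lt_b.
by have := Qk (s, sigma s, b) lt_b; rewrite ltNge gr.
Qed.

End jmdp.

Theorem proposition2 (R : realType) (J : jmdp R)
  (common_fixpoint : forall tau tau' : state J -> action J,
    optimal_selector tau -> optimal_selector tau' ->
    second_moment_fixpoint tau = second_moment_fixpoint tau')
  (q : nat -> state J -> action J -> R)
  (M : nat -> state J -> action J -> state J -> action J -> R)
  (sigma : nat -> state J -> action J)
  (sigma_greedy : forall k, greedy (q k) (sigma k))
  (q_update : forall k, q k.+1 = bellman (q k))
  (M_update : forall k, M k.+1 = second_moment_step (q k) (sigma k) (M k)) :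
  (forall s a, q k s a @[k --> \oo] --> Qstar s a) /\
  (forall tau : state J -> action J, optimal_selector tau ->
    forall s a s' a',
      M k s a s' a' @[k --> \oo] --> second_moment_fixpoint tau s a s' a').
Proof.
have /andP[g0 g1] := discount_itv J.
have qcvg s a : q k s a @[k --> \oo] --> Qstar s a.
  apply: (@perturbed_contraction_cvg R (state J * action J)%type (discount J)
    (fun k p => q k p.1 p.2) (fun p => Qstar p.1 p.2) _ _ (s, a)).
    by rewrite ltW.
  move=> d d0; apply: nearW => k e qe p; rewrite q_update -bellman_Qstar.
  (* Value iteration is an exact contraction: [d] is mere slack here. *)
  apply: ler_wpDr; first exact: ltW.
  by apply: bellman_dist => s1 a1; exact: (qe (s1, a1)).
split=> // tau tau_opt s a s' a'.
apply: (@perturbed_contraction_cvg R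
  (state J * action J * state J * action J)%type (discount J ^+ 2)
  (fun k p => M k p.1.1.1 p.1.1.2 p.1.2 p.2)
  (fun p => second_moment_fixpoint tau p.1.1.1 p.1.1.2 p.1.2 p.2)
  _ _ (s, a, s', a')).
  by rewrite exprn_ge0 ?ltW//= exprn_ilt1// ltW.
move=> d d0.
(* With [d / 2], the perturbation is [2 * gamma * (d / 2) = gamma * d], at most [d]. *)
have near_q : \forall k \near \oo, forall p : state J * action J,
    `|q k p.1 p.2 - Qstar p.1 p.2| <= d / 2.
  apply: filter_forall => p; apply: cvgr_distC_le; first exact: qcvg.
  by rewrite divr_gt0.
apply: filterS2 near_q (near_greedy qcvg) => k qk sigma_opt e Me p.
(* The limit is re-expressed as the fixed point for [sigma k], now optimal, so that it and [M k.+1]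
   are images under steps with the same selector. *)
have /(common_fixpoint _ _ tau_opt)-> := sigma_opt _ (sigma_greedy k).
rewrite M_update -second_moment_fixpointE.
apply: (le_trans (second_moment_step_dist (d := d / 2) (e := e) _ _ _ _ _ _ _)).
- by move=> s1 a1; exact: (qk (s1, a1)).
- move=> s1 a1 s2 a2; have := Me (s1, a1, s2, a2) => /=.
  by rewrite (common_fixpoint _ _ tau_opt (sigma_opt _ (sigma_greedy k))).
- by rewrite lerD2l mulrAC (mulrC 2) divfK// ler_piMr// ltW.
Qed.
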